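(* Fix a set $\mathsf{Atoms}$ of atomic propositions, a set $\mathsf{Compounds}\supseteq\mathsf{Atoms}$ of compound propositions, and a family $B$ of bonding functions. Let $M$ be a set of computations (infinite sequences over $\mathcal{P}(\mathsf{Atoms})$) that is recognized by some Büchi automaton. Let $\phi$ be a $\text{HyperLTL}_2$ formula of the form $\mathrm{A}^k\mathrm{E}^j\psi$ (a block of $k$ universal path quantifiers followed by a block of $j$ existential path quantifiers, followed by a quantifier-free body $\psi$), and let $n=k+j$. Let $A^n_M$ be a Büchi automaton over the alphabet $\mathcal{P}(\mathsf{Atoms})^n$ with $\mathcal{L}(A^n_M)=\{\mathit{zip}(\gamma_1,\dots,\gamma_n)\mid \gamma_1,\dots,\gamma_n\in M\}$, let $A^k_M$ be a Büchi automaton over $\mathcal{P}(\mathsf{Atoms})^k$ with $\mathcal{L}(A^k_M)=\{\mathit{zip}(\gamma_1,\dots,\gamma_k)\mid \gamma_1,\dots,\gamma_k\in M\}$, and let $A_\psi$ be a Büchi automaton over $\mathcal{P}(\mathsf{Atoms})^n$ whose language is the set of all infinite words $w$ with $\mathit{unzip}(w)\models\psi$. Then $\phi$ holds of $M$ (i.e., the empty tuple of computations satisfies $\phi$ with respect to model $M$ and bonding functions $B$) if and only if $\mathcal{L}\big(((A^n_M\cap A_\psi)|_k)^C\cap A^k_M\big)=\emptyset$.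
   Context: HyperLTL syntax: $\phi ::= \mathrm{A}\phi \mid \mathrm{E}\phi \mid \psi$ and $\psi ::= p \mid \neg\psi \mid \psi\vee\psi \mid \langle\psi,\dots,\psi\rangle \mid \mathrm{X}\psi \mid \psi\,\mathrm{U}\,\psi$, with $\wedge,\rightarrow,\leftrightarrow,\top,\bot$, $\mathrm{F}\psi=\top\,\mathrm{U}\,\psi$, $\mathrm{G}\psi=\neg\mathrm{F}\neg\psi$, $\psi_1\mathrm{R}\psi_2=\neg(\neg\psi_1\mathrm{U}\neg\psi_2)$ as abbreviations. A formula is well-formed if it has at least one path quantifier and every focus subformula $\langle\psi_1,\dots,\psi_m\rangle$ has $m$ equal to the number of leading path quantifiers. $\text{HyperLTL}_2$ is the fragment of well-formed formulas whose quantifier prefix has at most one alternation (a block of A's followed by a block of E's or vice versa) and in which every component $\psi_i$ of a focus formula is propositional (contains no X or U). Semantics: a computation $\gamma$ is an infinite sequence over $\mathcal{P}(\mathsf{Atoms})$, indexed from 1; $\gamma[i]$ is its $i$-th element and $\gamma[i..]$ its suffix from position $i$. For a finite tuple $\Gamma=(\gamma_1,\dots,\gamma_m)$, $\mathit{prj}_i(\Gamma)=\gamma_i$, $\Gamma\cdot\gamma=(\gamma_1,\dots,\gamma_m,\gamma)$, $\Gamma[i]=(\gamma_1[i],\dots,\gamma_m[i])$, $\Gamma[i..]=(\gamma_1[i..],\dots,\gamma_m[i..])$. A family of bonding functions is $B=\{B_i\}_{i\in\mathbb{N}}$ with $B_i:\mathcal{P}(\mathsf{Atoms})^i\to\mathcal{P}(\mathsf{Compounds})$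 and $B_1$ the identity; $B$ applied to an $i$-tuple means $B_i$. Given a model $M$ (set of computations) and $B$: $\Gamma\models\mathrm{A}\psi$ iff $\Gamma\cdot\gamma\models\psi$ for all $\gamma\in M$; $\Gamma\models\mathrm{E}\psi$ iff $\Gamma\cdot\gamma\models\psi$ for some $\gamma\in M$; $\Gamma\models p$ iff $p\in B(\Gamma[1])$; $\Gamma\models\neg\psi$ iff $\Gamma\not\models\psi$; $\Gamma\models\psi_1\vee\psi_2$ iff $\Gamma\models\psi_1$ or $\Gamma\models\psi_2$; $\Gamma\models\langle\psi_1,\dots,\psi_m\rangle$ iff $\mathit{prj}_i(\Gamma)\models\psi_i$ for all $1\le i\le m$; $\Gamma\models\mathrm{X}\psi$ iff $\Gamma[2..]\models\psi$; $\Gamma\models\psi_1\mathrm{U}\psi_2$ iff there is $k\ge1$ with $\Gamma[k..]\models\psi_2$ and $\Gamma[j..]\models\psi_1$ for all $1\le j<k$. $\mathit{zip}$ maps an $n$-tuple of infinite sequences to the infinite sequence of $n$-tuples (e.g. $\mathit{zip}([1,2,3],[4,5,6])=[(1,4),(2,5),(3,6)]$) and $\mathit{unzip}$ is its inverse. A Büchi automaton $(\Sigma,S,\Delta,S_0,F)$ accepts an infinite word if some run over it from an initial state visits $F$ infinitely often. $A\cap A'$ is an automaton recognizing $\mathcal{L}(A)\cap\mathcal{L}(A')$; $A^C$ is an automaton recognizing the complement of $\mathcal{L}(A)$ among all infinite words over its alphabet; for an automaton $A$ over alphabet $\mathcal{P}(\mathsf{Atoms})^n$, $A|_k$ is the automaton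 over $\mathcal{P}(\mathsf{Atoms})^k$ obtained by replacing every transition label (an $n$-tuple) by its first $k$ components, so that $\mathcal{L}(A|_k)$ consists of the first-$k$-component projections of words of $\mathcal{L}(A)$. *)

(* Defs.v *)
From mathcomp Require Import all_boot.
From mathcomp Require Import boolp classical_sets.

Set Implicit Arguments.
Unset Strict Implicit.
Unset Printing Implicit Defensive.

Local Open Scope classical_set_scope.

Inductive body (Compounds : Type) : Type :=
| Atm of Compounds
| Neg of body Compounds
| Or of body Compounds & body Compounds
| Focus of seq (body Compounds)
| Next of body Compounds
| Until of body Compounds & body Compounds.

Inductive formula (Compounds : Type) : Type :=
| All of formula Compounds
| Ex of formula Compounds
| Body of body Compounds.

Section Syntax.
Variable Compounds : Type.
Implicit Types (phi : formula Compounds) (psi : body Compounds).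

Inductive quantifier := QA | QE.

Fixpoint quants phi : seq quantifier :=
  match phi with
  | All phi' => QA :: quants phi'
  | Ex phi' => QE :: quants phi'
  | Body _ => [::]
  end.

Fixpoint body_of phi : body Compounds :=
  match phi with
  | All phi' | Ex phi' => body_of phi'
  | Body psi => psi
  end.

Fixpoint focus_arity (m : nat) psi : bool :=
  match psi with
  | Atm _ => true
  | Neg psi1 | Next psi1 => focus_arity m psi1
  | Or psi1 psi2 | Until psi1 psi2 => focus_arity m psi1 && focus_arity m psi2
  | Focus psis => (size psis == m) && all (focus_arity m) psis
  end.

Definition well_formed phi : Prop :=
  0 < size (quants phi) /\ focus_arity (size (quants phi)) (body_of phi).

Fixpoint propositional psi : bool :=
  match psi with
  | Atm _ => true
  | Neg psi1 => propositional psi1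
  | Or psi1 psi2 => propositional psi1 && propositional psi2
  | Focus psis => all propositional psis
  | Next _ | Until _ _ => false
  end.

Fixpoint focus_propositional psi : bool :=
  match psi with
  | Atm _ => true
  | Neg psi1 | Next psi1 => focus_propositional psi1
  | Or psi1 psi2 | Until psi1 psi2 =>
      focus_propositional psi1 && focus_propositional psi2
  | Focus psis => all propositional psis && all focus_propositional psis
  end.

Definition at_most_one_alternation phi : Prop :=
  exists a b : nat,
    quants phi = nseq a QA ++ nseq b QE \/ quants phi = nseq a QE ++ nseq b QA.

Definition HyperLTL2 phi : Prop :=
  [/\ well_formed phi, at_most_one_alternation phi
    & focus_propositional (body_of phi)].

Definition AkEj (k j : nat) psi : formula Compounds :=
  iter k (@All Compounds) (iter j (@Ex Compounds) (Body psi)).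

End Syntax.

(* Positions are numbered from 0 here: [w i] is the (i+1)-st element in the
   numbering from 1, so [wsuffix i w] is the suffix from position i+1. *)
Definition word (Sigma : Type) := nat -> Sigma.

Definition wsuffix (Sigma : Type) (i : nat) (w : word Sigma) : word Sigma :=
  fun l => w (i + l).

Definition at_pos (Sigma : Type) (n : nat) (G : n.-tuple (word Sigma))
    (i : nat) : n.-tuple Sigma :=
  [tuple tnth G l i | l < n].

Definition wsuffixes (Sigma : Type) (n : nat) (i : nat)
    (G : n.-tuple (word Sigma)) : n.-tuple (word Sigma) :=
  [tuple wsuffix i (tnth G l) | l < n].

Definition zipw (Sigma : Type) (n : nat) (G : n.-tuple (word Sigma)) :
    word (n.-tuple Sigma) :=
  at_pos G.

Definition unzipw (Sigma : Type) (n : nat) (w : word (n.-tuple Sigma)) :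
    n.-tuple (word Sigma) :=
  [tuple (fun i => tnth (w i) l) | l < n].

Definition zips (Sigma : Type) (n : nat) (M : set (word Sigma)) :
    set (word (n.-tuple Sigma)) :=
  [set zipw G | G in [set G : n.-tuple (word Sigma) | forall l, M (tnth G l)]].
Arguments zips [Sigma] n M.

Definition letter (Compounds : Type) (Atoms : set Compounds) : Type :=
  set (set_type Atoms).

Definition computation (Compounds : Type) (Atoms : set Compounds) : Type :=
  word (letter Atoms).

(* [bond1]: B_1 is the identity, a subset of Atoms being read as a subset of
   Compounds. *)
Record bonding (Compounds : Type) (Atoms : set Compounds) := Bonding {
  bond :> forall i : nat, i.-tuple (letter Atoms) -> set Compounds;
  bond1 : forall s : letter Atoms, bond [tuple s] = sval @` s }.

Section Semantics.
Variables (Compounds : Type) (Atoms : set Compounds) (B : bonding Atoms).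

(* In the focus case the components are evaluated on the one-element tuples
   prj_i(G); if prj_i(G) does not exist, the focus formula is false. *)
Fixpoint sat_body (n : nat) (G : n.-tuple (computation Atoms))
    (psi : body Compounds) {struct psi} : Prop :=
  match psi with
  | Atm p => B n (at_pos G 0) p
  | Neg psi1 => ~ sat_body G psi1
  | Or psi1 psi2 => sat_body G psi1 \/ sat_body G psi2
  | Focus psis =>
      (fix sat_focus (psis : seq (body Compounds))
           (gs : seq (computation Atoms)) {struct psis} : Prop :=
         match psis, gs with
         | [::], _ => True
         | psi1 :: psis', g :: gs' =>
             sat_body [tuple g] psi1 /\ sat_focus psis' gs'
         | _ :: _, [::] => False
         end) psis (tval G)
  | Next psi1 => sat_body (wsuffixes 1 G) psi1
  | Until psi1 psi2 =>
      exists i : nat, sat_body (wsuffixes i G) psi2 /\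
        forall l : nat, l < i -> sat_body (wsuffixes l G) psi1
  end.

Fixpoint sat (M : set (computation Atoms)) (n : nat)
    (G : n.-tuple (computation Atoms)) (phi : formula Compounds) : Prop :=
  match phi with
  | All phi' => forall g, M g -> sat M [tuple of rcons G g] phi'
  | Ex phi' => exists2 g, M g & sat M [tuple of rcons G g] phi'
  | Body psi => sat_body G psi
  end.

Definition holds (M : set (computation Atoms)) (phi : formula Compounds) :
    Prop :=
  sat M [tuple] phi.

End Semantics.

(* The state space is finite; the alphabet, a power of P(Atoms), is infinite
   when Atoms is. *)
Record buchi (Sigma : Type) := Buchi {
  state : finType;
  trans : state -> Sigma -> state -> Prop;
  init : set state;
  final : set state }.

Section Buchi.
Variable Sigma : Type.
Implicit Types A : buchi Sigma.

Definition run A (w : word Sigma) (r : nat -> state A) : Prop :=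
  init (r 0) /\ forall i, trans (r i) (w i) (r i.+1).

Definition accepts A (w : word Sigma) : Prop :=
  exists r : nat -> state A,
    run w r /\ forall i, exists2 l, i <= l & final (r l).

Definition lang A : set (word Sigma) := [set w | accepts A w].

(* [is_inter A1 A2 D]: D is an automaton "A1 ∩ A2".
   [is_compl A C]: C is an automaton "A^C". *)
Definition is_inter A1 A2 (D : buchi Sigma) : Prop :=
  lang D = lang A1 `&` lang A2.

Definition is_compl A (C : buchi Sigma) : Prop := lang C = ~` lang A.

End Buchi.

(* A|_k, meant for k <= n *)
Definition restrict (Sigma : Type) (n k : nat) (A : buchi (n.-tuple Sigma)) :
    buchi (k.-tuple Sigma) :=
  {| state := state A;
     trans := fun s (a : k.-tuple Sigma) t => exists2 b : n.-tuple Sigma,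
                trans s b t & take k b = a :> seq Sigma;
     init := @init _ A;
     final := @final _ A |}.

(* Main.v *)
Require Import Defs.
From mathcomp Require Import all_boot.
From mathcomp Require Import boolp classical_sets.

(** A word lies in the language of [restrict k A] iff it is the projection to
    the first [k] components of a word in the language of [A]. So the language
    of the restricted intersection consists of the zips of those [k]-tuples that
    extend by [j] computations of [M] to a tuple satisfying [psi]; the final
    automaton accepts exactly the zips of the [k]-tuples over [M] that violate
    the existential part of the formula. *)

Local Open Scope classical_set_scope.

Lemma forall_tnth_cons (T : Type) (P : T -> Prop) (n : nat) (x : T)
    (t : n.-tuple T) :
  (forall l, P (tnth [tuple of x :: t] l)) <-> P x /\ forall l, P (tnth t l).
Proof.
split=> [h|[hx ht] l].
  split; first by have := h ord0; rewrite tnth0.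
  by move=> l; have := h (lift ord0 l); rewrite tnthS.
by case: (unliftP ord0 l) => [l'|] ->; rewrite ?tnthS ?tnth0.
Qed.

Lemma forall_tnth_cat (T : Type) (P : T -> Prop) (m n : nat)
    (s : m.-tuple T) (t : n.-tuple T) :
  (forall l, P (tnth [tuple of s ++ t] l)) <->
  (forall l, P (tnth s l)) /\ forall l, P (tnth t l).
Proof.
split=> [h|[hs ht] l].
  by split=> l; [have := h (lshift n l); rewrite tnth_lshift
                |have := h (rshift m l); rewrite tnth_rshift].
by case: (split_ordP l) => l' ->; rewrite ?tnth_lshift ?tnth_rshift.
Qed.

Lemma tuple_splitP (T : Type) (m n : nat) (t : (m + n).-tuple T) :
  exists (u : m.-tuple T) (v : n.-tuple T), t = [tuple of u ++ v].
Proof.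
exists [tuple tnth t (lshift n i) | i < m], [tuple tnth t (rshift m i) | i < n].
apply: eq_from_tnth => l.
by case: (split_ordP l) => l' ->; rewrite ?tnth_lshift ?tnth_rshift tnth_mktuple.
Qed.

Lemma zipwK (Sigma : Type) (n : nat) : cancel (@zipw Sigma n) (@unzipw Sigma n).
Proof.
move=> G; apply: eq_from_tnth => l; rewrite tnth_mktuple.
by apply/funext => i; rewrite tnth_mktuple.
Qed.

(** Passing to the underlying sequences lets [take] and [++] be computed without matching tuple
    lengths. *)
Lemma zipw_val (Sigma : Type) (n : nat) (G : n.-tuple (word Sigma)) (i : nat) :
  zipw G i = [seq g i | g <- G] :> seq Sigma.
Proof.
rewrite -[RHS]/(tval [tuple of [seq g i | g <- G]]); congr tval.
by apply: eq_from_tnth => l; rewrite tnth_mktuple tnth_map.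
Qed.

Lemma take_zipw_cat (Sigma : Type) (k j : nat) (G : k.-tuple (word Sigma))
    (H : j.-tuple (word Sigma)) (i : nat) :
  take k (zipw [tuple of G ++ H] i) = zipw G i :> seq Sigma.
Proof. by rewrite !zipw_val map_cat take_size_cat // size_map size_tuple. Qed.

(** Restriction keeps states, initial and final states, so one and the same run serves on both
    sides; only the letters have to be extended or cut. *)
Lemma lang_restrict (Sigma : Type) (n k : nat) (A : buchi (n.-tuple Sigma))
    (w : word (k.-tuple Sigma)) :
  lang (restrict k A) w <->
  exists2 v, lang A v & forall i, take k (v i) = w i :> seq Sigma.
Proof.
split=> [[r [[r0 rS] rF]]|[v [r [[r0 rS] rF]] vw]]; last first.
  by exists r; split=> //; split=> // i; exists (v i).
(* Each transition of the restricted run comes from some full letter; choosing one at every position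
   yields the word [v]. *)
have /choice[v vP] : forall i, exists b : n.-tuple Sigma,
    trans (r i : state A) b (r i.+1) /\ take k b = w i :> seq Sigma.
  by move=> i; case: (rS i) => b; exists b.
exists v => [|i]; last by case: (vP i).
by exists r; split=> //; split=> // i; case: (vP i).
Qed.

Section Quantifiers.
Variables (Compounds : Type) (Atoms : set Compounds) (B : bonding Atoms).
Variable M : set (computation Atoms).
Implicit Type phi : formula Compounds.

(** Tuples such as [rcons G g ++ H] and [G ++ g :: H] have the same entries but types indexed by
    different length expressions, so satisfaction is transported along equality of the sequences. *)
Lemma sat_val {m n : nat} {G : m.-tuple (computation Atoms)}
    {H : n.-tuple (computation Atoms)} {phi} :
  G = H :> seq _ -> sat B M G phi -> sat B M H phi.
Proof.
move=> GH; have emn : m = n by rewrite -(size_tuple G) GH size_tuple.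
by move: H GH; case: _ / emn => H /val_inj ->.
Qed.

(** Induction on [k] for arbitrary [G]: the computation that the outermost quantifier appends to [G]
    becomes the head of [H]. *)
Lemma sat_All (k m : nat) (G : m.-tuple (computation Atoms)) phi :
  sat B M G (iter k (@All Compounds) phi) <->
  forall H : k.-tuple (computation Atoms), (forall l, M (tnth H l)) ->
    sat B M [tuple of G ++ H] phi.
Proof.
elim: k m G => [|k IH] m G /=.
  have E (H : 0.-tuple _) : G ++ H = G by rewrite tuple0 /= cats0.
  split=> [h H _|h]; first exact: sat_val (esym (E H)) h.
  (* Membership in [M] is vacuous here, the empty tuple having no index. *)
  by apply: (sat_val (E [tuple])); apply: h => -[].
split=> [h H|h g Mg].
  case/tupleP: H => g H /forall_tnth_cons[Mg MH].
  have /IH/(_ H MH) := h g Mg.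
  by apply: sat_val; rewrite /= cat_rcons.
apply/IH => H MH.
have /h : forall l, M (tnth [tuple of g :: H] l) by apply/forall_tnth_cons.
by apply: sat_val; rewrite /= cat_rcons.
Qed.

Lemma sat_Ex (k m : nat) (G : m.-tuple (computation Atoms)) phi :
  sat B M G (iter k (@Ex Compounds) phi) <->
  exists2 H : k.-tuple (computation Atoms), forall l, M (tnth H l) &
    sat B M [tuple of G ++ H] phi.
Proof.
elim: k m G => [|k IH] m G /=.
  have E (H : 0.-tuple _) : G ++ H = G by rewrite tuple0 /= cats0.
  split=> [h|[H _]]; last exact: sat_val (E H).
  by exists [tuple] => [[]//|]; exact: sat_val (esym (E [tuple])) h.
split=> [[g Mg /IH[H MH h]]|[H]].
  exists [tuple of g :: H]; first exact/forall_tnth_cons.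
  by move: h; apply: sat_val; rewrite /= cat_rcons.
case/tupleP: H => g H /forall_tnth_cons[Mg MH] h.
exists g => //; apply/IH; exists H => //.
by move: h; apply: sat_val; rewrite /= cat_rcons.
Qed.

Lemma holds_AkEj (k j : nat) (psi : body Compounds) :
  holds B M (AkEj k j psi) <->
  forall G : k.-tuple (computation Atoms), (forall l, M (tnth G l)) ->
    exists2 H : j.-tuple (computation Atoms), forall l, M (tnth H l) &
      sat_body B [tuple of G ++ H] psi.
Proof.
rewrite /holds sat_All; split=> h G /h GH.
  (* [sat_All] at the empty tuple speaks of [[tuple] ++ G]; [sat_val] replaces it by [G]. The
     formula is given explicitly because [sat_body] is [sat] at [Body psi] only up to conversion. *)
  by apply/(sat_Ex j k G (Body psi)); apply: sat_val GH.
by apply: (@sat_val _ _ G) => //; apply/sat_Ex.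
Qed.

End Quantifiers.

Theorem theorem1 (Compounds : Type) (Atoms : set Compounds)
  (B : bonding Atoms)
  (M : set (computation Atoms))
  (hM : exists A : buchi (letter Atoms), lang A = M)
  (k j : nat) (psi : body Compounds) (phi : formula Compounds)
  (hphi : HyperLTL2 phi) (phiE : phi = AkEj k j psi)
  (AnM : buchi ((k + j).-tuple (letter Atoms)))
  (hAnM : lang AnM = zips (k + j) M)
  (AkM : buchi (k.-tuple (letter Atoms)))
  (hAkM : lang AkM = zips k M)
  (Apsi : buchi ((k + j).-tuple (letter Atoms)))
  (hApsi : lang Apsi = [set w | sat_body B (unzipw w) psi])
  (AI : buchi ((k + j).-tuple (letter Atoms)))
  (hAI : is_inter AnM Apsi AI)
  (AC : buchi (k.-tuple (letter Atoms)))
  (hAC : is_compl (restrict k AI) AC)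
  (AD : buchi (k.-tuple (letter Atoms)))
  (hAD : is_inter AC AkM AD) :
  holds B M phi <-> lang AD = set0.
Proof.
have inAI G : (forall l, M (tnth G l)) ->
    lang (restrict k AI) (zipw G) <->
    exists2 H : j.-tuple (computation Atoms), forall l, M (tnth H l) &
      sat_body B [tuple of G ++ H] psi.
  move=> MG; rewrite lang_restrict hAI hAnM hApsi; split.
    move=> [v [[GH MGH <-{v}] /=]]; rewrite zipwK.
    case: (tuple_splitP _ _ _ GH) MGH => G' [H ->] /forall_tnth_cat[_ MH] sH e.
    (* The first [k] components [G'] of the accepted word have the same zip as [G] by [e], and
       [zipw] is injective. *)
    suff -> : G = G' by exists H.
    apply/(can_inj (@zipwK _ _))/funext => i; apply: val_inj.
    by rewrite /= -e take_zipw_cat.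
  move=> [H MH sH]; exists (zipw [tuple of G ++ H]); last exact: take_zipw_cat.
  split; last by rewrite /= zipwK.
  by exists [tuple of G ++ H] => //; apply/forall_tnth_cat.
rewrite phiE holds_AkEj hAD hAC hAkM; split=> [h|D0 G MG].
  (* A word of [AD] is the zip of some [G] over [M]; by [h] and [inAI] it lies in the language that
     [AC] complements. *)
  by rewrite -subset0 => w [nAI [G MG Gw]]; apply: nAI; rewrite -Gw; apply/inAI/h.
(* Were the zip of [G] rejected by the restriction, both [AC] and [AkM] would accept it, and so
   would [AD]. *)
apply/(inAI G MG); apply: contrapT => nAI.
suff : set0 (zipw G) by [].
by rewrite -D0; split=> //; exists G.
Qed.
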